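(* Let $k \geq 5$ be an integer and let $P$ be the set of primes $p \equiv 1 \pmod 4$. There exists a sequence of graphs $(G_p)_{p \in P}$ such that $G_p$ has $n = 2kp^2$ vertices, $\Theta(n^{3/2})$ edges (as $p \to \infty$), and every edge of every $G_p$ is contained in exactly one subgraph of $G_p$ isomorphic to $H_k$.
   Context: For an integer $k \geq 3$, $H_k$ denotes the graph with vertex set $\{1,2,\dots,2k\}$ and edge set $\{\{1,i\},\{2,i\},\{3,j\},\{4,j\} : 3 \leq i \leq k+2 < j \leq 2k\}$. A ''copy of $H_k$'' in a graph $G$ is a (not necessarily induced) subgraph of $G$ isomorphic to $H_k$. *)

(* Defs.v *)
From HB Require Import structures.
From mathcomp Require Import all_boot all_order all_algebra.
From mathcomp Require Import zify.

Set Implicit Arguments.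
Unset Strict Implicit.
Unset Printing Implicit Defensive.

Record sgraph := SGraph {
  vertex :> finType;
  adj : rel vertex;
  adj_sym : symmetric adj;
  adj_irr : irreflexive adj }.

Definition edges (G : sgraph) : {set {set G}} :=
  [set [set u.1; u.2] | u : G * G & adj u.1 u.2].

Lemma edgesP (G : sgraph) (x y : G) : ([set x; y] \in edges G) = adj x y.
Proof.
apply/imsetP/idP => [[[a b] /=]|xy]; last by exists (x, y); rewrite ?inE.
rewrite inE /= => ab E.
have ba : adj b a by rewrite adj_sym.
have : a \in [set x; y] by rewrite E set21.
have : b \in [set x; y] by rewrite E set22.
rewrite !inE => b_xy a_xy.
have nab : a != b by apply: contraTneq ab => ->; rewrite adj_irr.
case/orP: a_xy nab ab ba => /eqP ->; case/orP: b_xy => /eqP ->;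
  by rewrite ?eqxx.
Qed.

Definition isomorphic (G H : sgraph) :=
  exists f : G -> H, bijective f /\ {mono f : x y / adj x y}.

(* Not necessarily induced: an arbitrary set of edges of G together with a set
   of vertices containing their endpoints. *)
Record subgraph (G : sgraph) := Subgraph {
  sub_vertices : {set G};
  sub_edges : {set {set G}};
  sub_edgesP : (sub_edges \subset edges G) &&
               [forall e in sub_edges, e \subset sub_vertices] }.

Section SubgraphSGraph.
Variables (G : sgraph) (S : subgraph G).

Definition sub_vertex : finType := {x : G | x \in sub_vertices S}.

Definition sub_adj (x y : sub_vertex) := [set val x; val y] \in sub_edges S.

Lemma sub_adj_sym : symmetric sub_adj.
Proof. by move=> x y; rewrite /sub_adj setUC. Qed.

Lemma sub_adj_irr : irreflexive sub_adj.
Proof.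
move=> x; apply/negP => xx; case/andP: (sub_edgesP S) => /subsetP/(_ _ xx).
by rewrite edgesP adj_irr.
Qed.

Definition sgraph_of_subgraph : sgraph := SGraph sub_adj_sym sub_adj_irr.

End SubgraphSGraph.

(* [Hk_arc k i j] orients the edges of H_k, on the labels 1, ..., 2k. *)
Definition Hk_arc (k i j : nat) : bool :=
  ((i \in [:: 1; 2]) && (3 <= j <= k + 2)) ||
  ((i \in [:: 3; 4]) && (k + 2 < j <= 2 * k)).

(* The ordinal x : 'I_(2 * k) stands for the label x + 1. *)
Definition Hk_adj (k : nat) : rel 'I_(2 * k) :=
  fun x y => Hk_arc k x.+1 y.+1 || Hk_arc k y.+1 x.+1.

Lemma Hk_adj_sym k : symmetric (@Hk_adj k).
Proof. by move=> x y; rewrite /Hk_adj orbC. Qed.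

Lemma Hk_adj_irr k : irreflexive (@Hk_adj k).
Proof. by move=> x; rewrite /Hk_adj /Hk_arc !inE; lia. Qed.

Definition Hk (k : nat) : sgraph := SGraph (@Hk_adj_sym k) (@Hk_adj_irr k).

Definition prime_1mod4 (p : nat) : Prop := prime p /\ p = 1 %[mod 4].

(* Main.v *)
(* Fix distinct values lambda_i in F_p, one for each vertex i of H_k, and place
   the vertex (i, x, y) of G at the point (x, y, lambda_i) of F_p^3.  Join two
   vertices when their types are adjacent in H_k and their difference
   (X, Y, L) satisfies X^2 = L Y.  Each of the p^3 lines in a direction
   (t, t^2, 1) carries one copy of H_k, and each edge lies on exactly one of
   these lines.  As in a generalized quadrangle, there are no triangles except
   within a line, so a copy of H_k lies on a line as soon as its vertices 1, 2
   or its vertices 3, 4 do.  If u and v are on no common line, they have at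
   most two common neighbours of each type, and at most one if u and v have the
   same type.  If their types i, i' differ, a type j occurs among the common
   neighbours only if (lambda_j - lambda_i) (lambda_j - lambda_i') D is a
   square, where D <> 0 depends only on u and v.  The lambda_i are chosen so
   that a type among 1, 2, 3, 4 and a type of degree 2 never both occur; as
   k >= 5, this forces the images of 1 and 2 to have equal types, and likewise
   those of 3 and 4, which contradicts the bound "at most one".  For small p
   there is no room for the lambda_i, and the edgeless graph is used. *)
Require Import Defs.
From HB Require Import structures.
From mathcomp Require Import all_boot all_order all_algebra.
From mathcomp Require Import zify ring.
Import Order.TTheory GRing.Theory Num.Theory.

Set Implicit Arguments.
Unset Strict Implicit.
Unset Printing Implicit Defensive.

(** * Copies of a graph as images of injective homomorphisms *)

Definition ghom (H G : sgraph) (f : H -> G) :=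
  forall x y, adj x y -> adj (f x) (f y).

Lemma edges_imset (H G : sgraph) (f : H -> G) :
  ghom f -> forall e, e \in edges H -> f @: e \in edges G.
Proof.
move=> hf e /imsetP [[x y]]; rewrite inE /= => xy ->.
by rewrite imsetU !imset_set1 edgesP hf.
Qed.

(** An injective endomorphism permutes the finite edge set, so composing a copy with one leaves its
    edges unchanged. *)
Lemma imset_edges_endo (H : sgraph) (f : H -> H) :
  ghom f -> injective f -> [set f @: (e : {set H}) | e in edges H] = edges H.
Proof.
move=> hf fI; apply/eqP; rewrite eqEcard; apply/andP; split.
  by apply/subsetP => _ /imsetP [e eH ->]; exact: edges_imset.
by rewrite (card_imset _ (imset_inj fI)).
Qed.

Lemma subgraph_inj (G : sgraph) (S S' : subgraph G) :
  sub_vertices S = sub_vertices S' -> sub_edges S = sub_edges S' -> S = S'.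
Proof.
case: S S' => [V E p] [V' E' p'] /= EV EE.
by move: p p'; rewrite EV EE => p p'; rewrite (bool_irrelevance p p').
Qed.

Section ImageSubgraph.
Variables (H G : sgraph) (f : H -> G).

Lemma image_subgraph_subproof (hf : ghom f) :
  ([set f @: (e : {set H}) | e in edges H] \subset edges G) &&
  [forall e in [set f @: (e : {set H}) | e in edges H],
     e \subset f @: [set: H]].
Proof.
apply/andP; split.
  by apply/subsetP => _ /imsetP [e eH ->]; exact: edges_imset.
by apply/forall_inP => _ /imsetP [e _ ->]; apply: imsetS; exact: subsetT.
Qed.

Definition image_subgraph (hf : ghom f) : subgraph G :=
  Subgraph (image_subgraph_subproof hf).

Lemma image_subgraph_edge (fI : injective f) x y :
  ([set f x; f y] \in [set f @: (e : {set H}) | e in edges H]) = adj x y.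
Proof.
rewrite -edgesP -(mem_imset _ _ (imset_inj fI)).
by rewrite imsetU !imset_set1.
Qed.

Lemma image_subgraph_iso (hf : ghom f) :
  injective f -> isomorphic (sgraph_of_subgraph (image_subgraph hf)) H.
Proof.
move=> fI.
have fV x : f x \in sub_vertices (image_subgraph hf) by exact: imset_f.
pose g x : sgraph_of_subgraph (image_subgraph hf) := exist _ (f x) (fV x).
have gI : injective g by move=> x y [] /fI.
have [|g' gK g'K] := inj_card_bij gI.
  by rewrite card_sig -cardsT -(card_imset _ fI) subset_leq_card.
exists g'; split; first by exists g.
move=> x y; rewrite -{2}(g'K x) -{2}(g'K y) -(image_subgraph_edge fI).
by [].
Qed.

End ImageSubgraph.

(** Take for [f] the inverse isomorphism followed by the inclusion. *)
Lemma isomorphic_image_subgraph (H G : sgraph) (S : subgraph G) :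
  isomorphic (sgraph_of_subgraph S) H ->
  exists (f : H -> G) (hf : ghom f), injective f /\ S = image_subgraph hf.
Proof.
case=> g [[g' gK g'K] gm].
case/andP: (sub_edgesP S) => /subsetP SE /forall_inP SV.
pose f x := val (g' x).
have fE x y : ([set f x; f y] \in sub_edges S) = adj x y.
  by rewrite -{2}(g'K x) -{2}(g'K y) gm.
have hf : ghom f by move=> x y; rewrite -fE => /SE; rewrite edgesP.
have fI : injective f by move=> x y /val_inj /(can_inj g'K).
have gf v (vS : v \in sub_vertices S) : exists x, v = f x.
  by exists (g (exist _ v vS)); rewrite /f gK.
exists f, hf; split => //; apply: subgraph_inj => /=.
  apply/setP => v; apply/idP/imsetP => [/gf [x ->]|[x _ ->]]; first by exists x.
  exact: (valP (g' x)).
apply/setP => e; apply/idP/idP => [eS|].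
  have /imsetP [[a b]] := SE _ eS; rewrite inE /= => ab eE.
  have /subsetP es := SV _ eS; move: eS; rewrite eE.
  have [|x ->] := gf a; first by apply: es; rewrite eE set21.
  have [|y ->] := gf b; first by apply: es; rewrite eE set22.
  by rewrite fE image_subgraph_edge.
case/imsetP => e' /imsetP [[x y]]; rewrite inE /= => xy -> ->.
by rewrite imsetU !imset_set1 fE.
Qed.

Local Open Scope ring_scope.

(** * The cone graph: lines and common neighbours *)

Lemma card_sqrt (F : finFieldType) (a : F) :
  (#|[set z : F | z ^+ 2 == a]| <= 2)%N.
Proof.
have [->|[z]] := set_0Vmem [set z : F | z ^+ 2 == a]; first by rewrite cards0.
rewrite inE => /eqP <-; apply: (@leq_trans #|[set z; - z]|).
  by apply/subset_leq_card/subsetP => y; rewrite !inE eqf_sqr.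
by rewrite cards2; case: (_ != _).
Qed.

Section ConeGraph.
Variables (F : finFieldType) (H : sgraph) (lam : H -> F).
Hypothesis lam_inj : injective lam.

Implicit Types (u v w : H * (F * F)) (l : F * F * F) (i j : H).

(** The zeros of X^2 - L Y form a cone over a conic; those with L <> 0 are the nonzero multiples of
    the vectors (t, t^2, 1). *)
Definition cone_form u v : F :=
  (u.2.1 - v.2.1) ^+ 2 - (lam u.1 - lam v.1) * (u.2.2 - v.2.2).

Definition cone_adj : rel (H * (F * F)) :=
  fun u v => adj u.1 v.1 && (cone_form u v == 0).

Lemma cone_formC u v : cone_form u v = cone_form v u.
Proof. by rewrite /cone_form; ring. Qed.

Lemma cone_adj_sym : symmetric cone_adj.
Proof. by move=> u v; rewrite /cone_adj adj_sym cone_formC. Qed.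

Lemma cone_adj_irr : irreflexive cone_adj.
Proof. by move=> u; rewrite /cone_adj adj_irr. Qed.

Definition cone_graph : sgraph := SGraph cone_adj_sym cone_adj_irr.

Lemma card_cone_graph : #|cone_graph| = (#|H| * #|F| ^ 2)%N.
Proof. by rewrite card_prod card_prod mulnn. Qed.

Lemma adj_lam_neq i j : adj i j -> lam i - lam j != 0.
Proof.
move=> ij; rewrite subr_eq0 (inj_eq lam_inj).
by apply: contraTneq ij => ->; rewrite adj_irr.
Qed.

(* The triple ((X, Y), t) encodes the line through (X, Y, 0) with direction
   (t, t ^ 2, 1). *)
Definition line_point l i : cone_graph :=
  (i, (l.1.1 + lam i * l.2, l.1.2 + lam i * l.2 ^+ 2)).

Lemma line_point_inj l : injective (line_point l).
Proof. by move=> i j []. Qed.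

Lemma line_point_hom l : ghom (line_point l).
Proof.
move=> i j ij; rewrite /= /cone_adj /= ij /=; apply/eqP.
by rewrite /cone_form /=; ring.
Qed.

(** The slope is t = X / L; then X^2 = L Y forces Y = L t^2. *)
Lemma line_through u v : lam u.1 != lam v.1 -> cone_form u v = 0 ->
  exists l, u = line_point l u.1 /\ v = line_point l v.1.
Proof.
case: u v => [i [x y]] [j [x' y']]; rewrite /cone_form /= -subr_eq0 => d0 E.
pose t := (x - x') / (lam i - lam j).
have xE : x - x' = (lam i - lam j) * t by rewrite mulrC divfK.
have yE : y - y' = (lam i - lam j) * t ^+ 2.
  apply: (mulfI d0); apply/esym/eqP; rewrite -subr_eq0 -E xE; apply/eqP.
  by ring.
have {}xE : x = x' + (lam i - lam j) * t by rewrite -xE addrC subrK.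
have {}yE : y = y' + (lam i - lam j) * t ^+ 2 by rewrite -yE addrC subrK.
exists (x - lam i * t, y - lam i * t ^+ 2, t).
by split; rewrite /line_point /=; congr (_, (_, _)); ring: xE yE.
Qed.

Lemma adj_line u v : cone_adj u v ->
  exists l, u = line_point l u.1 /\ v = line_point l v.1.
Proof.
case/andP => ij /eqP uv; apply: line_through => //.
by rewrite -subr_eq0 adj_lam_neq.
Qed.

Lemma line_unique i j l l' : i != j ->
  line_point l i = line_point l' i -> line_point l j = line_point l' j ->
  l = l'.
Proof.
case: l l' => [[X Y] t] [[X' Y'] t']; rewrite -(inj_eq lam_inj) -subr_eq0 => d0.
case=> /= E1 E2 [/= E3 E4].
have tt : t = t'.
  apply: (mulfI d0).
  transitivity ((X + lam i * t) - (X + lam j * t)); first by ring.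
  by rewrite E1 E3; ring.
rewrite tt in E1 E2 *.
by rewrite (addIr _ E1) (addIr _ E2).
Qed.

(* There are no triangles other than those within a line. *)
Lemma line_common_neighbour l i j w : i != j ->
  cone_adj w (line_point l i) -> cone_adj w (line_point l j) ->
  w = line_point l w.1.
Proof.
case: l w => [[X Y] t] [m [x y]].
rewrite -(inj_eq lam_inj) -subr_eq0 => d0.
case/andP => _ /eqP /= E1 /andP [_ /eqP /= E2].
rewrite /cone_form /= in E1 E2; rewrite /line_point /=.
(* [xi], [eta] measure [w] from the point of the line at height [lam m]. The adjacencies become xi^2
   = (lam m - lam i) (eta - 2 t xi) and the same with [j]; as lam i <> lam j, both sides vanish. *)
pose xi := x - X - lam m * t; pose eta := y - Y - lam m * t ^+ 2.
have etaE : eta = 2%:R * t * xi.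
  apply: (mulfI d0); apply/eqP; rewrite -subr_eq0; apply/eqP.
  by rewrite -[RHS](subrr 0) -{1}E1 -E2 /eta /xi; ring.
have xi0 : xi = 0.
  apply/eqP; rewrite -sqrf_eq0; apply/eqP.
  transitivity ((lam m - lam i) * (eta - 2%:R * t * xi)); last first.
    by rewrite etaE subrr mulr0.
  apply/eqP; rewrite -subr_eq0 -E1; apply/eqP; rewrite /eta /xi; ring.
have eta0 : eta = 0 by rewrite etaE xi0 mulr0.
congr (_, (_, _)); apply/eqP; rewrite -subr_eq0.
  by rewrite -xi0 /xi opprD addrA.
by rewrite -eta0 /eta opprD addrA.
Qed.

(* Eliminating the y-coordinate of a common neighbour w of u and v leaves a
   quadratic equation for its x-coordinate; this is half the derivative of that
   quadratic, so its square is the (reduced) discriminant. *)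
Definition disc_root u v w : F :=
  (lam u.1 - lam v.1) * w.2.1 -
  (u.2.1 * (lam w.1 - lam v.1) - v.2.1 * (lam w.1 - lam u.1)).

Lemma disc_root_sqr u v w : cone_adj w u -> cone_adj w v ->
  disc_root u v w ^+ 2 =
    (lam w.1 - lam u.1) * (lam w.1 - lam v.1) * cone_form u v.
Proof.
case: u v w => [i [x1 y1]] [j [x2 y2]] [m [x y]].
case/andP => _ /= /eqP E1 /andP [_ /= /eqP E2].
rewrite /disc_root /cone_form /= in E1 E2 *.
apply/eqP; rewrite -subr_eq0; apply/eqP.
(* The zeros stand for the forms at (w, u) and (w, v); in this combination y cancels. *)
transitivity ((lam i - lam j) * ((lam m - lam j) * 0 - (lam m - lam i) * 0)).
  by rewrite -{1}E1 -E2; ring.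
by rewrite !mulr0 subrr mulr0.
Qed.

(** Adjacent types have L <> 0, so X^2 = L Y determines y from x. *)
Lemma neighbour_inj u w w' : cone_adj w u -> cone_adj w' u ->
  w.1 = w'.1 -> w.2.1 = w'.2.1 -> w = w'.
Proof.
case: u w w' => [i [x1 y1]] [m [x y]] [m' [x' y']] /andP [/= mi /eqP E1].
move=> /andP [_ /= /eqP E2] /= mm' xx'; move: E1 E2.
rewrite -mm' -xx' /cone_form /= => E1 E2; congr (_, (_, _)).
apply: (mulfI (adj_lam_neq mi)); apply/eqP; rewrite -subr_eq0; apply/eqP.
by rewrite -[RHS](subrr 0) -{1}E2 -E1; ring.
Qed.

Definition common_neighbours u v : {set cone_graph} :=
  [set w | cone_adj w u && cone_adj w v].

Hypothesis two_neq0 : 2%:R != 0 :> F.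

(** Subtracting the equations of [w] for [u] and [v] cancels y and leaves a linear equation in x
    with leading coefficient 2 (x2 - x1). Here x1 = x2 would give y1 = y2, so u = v. *)
Lemma common_neighbour_same_type u v w w' : u != v -> u.1 = v.1 ->
  w \in common_neighbours u v -> w' \in common_neighbours u v ->
  w.1 = w'.1 -> w = w'.
Proof.
rewrite !inE => uv uv1 /andP [wu wv] /andP [w'u w'v] ww'.
apply: (neighbour_inj wu w'u ww'); move: uv uv1 wu wv w'u w'v ww'.
case: u v w w' => [i [x1 y1]] [j [x2 y2]] [m [x y]] [m' [x' y']] /= uv ij.
rewrite -{}ij in uv * => /andP [/= mi /eqP E1] /andP [_ /= /eqP E2].
move=> /andP [_ /= /eqP E3] /andP [_ /= /eqP E4] mm'.
rewrite -mm' /cone_form /= in E1 E2 E3 E4.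
have x12 : x2 - x1 != 0.
  apply: contraNneq uv => /eqP; rewrite subr_eq0 => /eqP x21.
  rewrite x21 in E2 *; suff -> : y1 = y2 by [].
  apply: (mulfI (adj_lam_neq mi)); apply/eqP; rewrite -subr_eq0; apply/eqP.
  by rewrite -[RHS](subrr 0) -{1}E1 -E2; ring.
apply: (mulfI x12); apply: (mulfI two_neq0); apply/eqP.
rewrite -subr_eq0; apply/eqP.
transitivity (0 - 0 - (0 - 0) : F); last by rewrite !subrr.
by rewrite -{1}E1 -{1}E2 -{1}E3 -E4; ring.
Qed.

(** For distinct types of [u] and [v], [disc_root u v] is injective on common neighbours of type
    [j], and its square depends only on [j]. *)
Lemma card_common_neighbours_type u v j : u != v ->
  (#|[set w in common_neighbours u v | w.1 == j]| <= 2)%N.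
Proof.
move=> uv; have [uv1|uv1] := eqVneq u.1 v.1.
  apply: (@leq_trans 1%N) => //; apply/card_le1_eqP => w w'.
  rewrite !in_set => /andP [wN /eqP wj] /andP [w'N /eqP w'j].
  by apply: (common_neighbour_same_type uv uv1); rewrite ?wj ?w'j // inE.
have d0 : lam u.1 - lam v.1 != 0 by rewrite subr_eq0 (inj_eq lam_inj).
rewrite -(@card_in_imset _ _ (disc_root u v)); last first.
  move=> w w'; rewrite !in_set => /andP [/andP [wu wv] /eqP wj].
  move=> /andP [/andP [w'u w'v] /eqP w'j].
  rewrite /disc_root wj w'j => /addIr /(mulfI d0).
  by apply: (neighbour_inj wu w'u); rewrite wj w'j.
apply: leq_trans
  (card_sqrt ((lam j - lam u.1) * (lam j - lam v.1) * cone_form u v)).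
apply/subset_leq_card/subsetP => _ /imsetP [w wN ->].
move: wN; rewrite !inE => /andP [/andP [wu wv] /eqP <-].
by rewrite disc_root_sqr.
Qed.

Lemma card_common_neighbours u v (T : {set H}) : u != v ->
  (forall w, w \in common_neighbours u v -> w.1 \in T) ->
  (#|common_neighbours u v| <= #|T| * 2)%N.
Proof.
move=> uv NT; rewrite -sum1_card (partition_big fst (mem T)) //=.
rewrite -sum_nat_const; apply: leq_sum => j _.
rewrite sum1_card; apply: leq_trans (card_common_neighbours_type j uv).
by apply/subset_leq_card/subsetP => w wj; rewrite in_set.
Qed.

(** * Counting edges and copies *)

Lemma card_edges_ge i j : adj i j -> (#|F| ^ 3 <= #|edges cone_graph|)%N.
Proof.
move=> ij; have ij' : i != j by apply: contraTneq ij => ->; rewrite adj_irr.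
have <- : #|{: F * F * F}| = (#|F| ^ 3)%N.
  by rewrite !card_prod expnSr -mulnn.
pose e l := [set line_point l i; line_point l j].
rewrite -(card_imset _ (_ : injective e)).
  apply/subset_leq_card/subsetP => _ /imsetP [l _ ->].
  by rewrite edgesP; apply: line_point_hom.
move=> l l' E; apply: (line_unique ij').
  have : line_point l i \in e l' by rewrite -E set21.
  by rewrite !inE => /orP [] /eqP // [E']; rewrite E' eqxx in ij'.
have : line_point l j \in e l' by rewrite -E set22.
by rewrite !inE => /orP [] /eqP // [E']; rewrite E' eqxx in ij'.
Qed.

Lemma card_edges_le : (#|edges cone_graph| <= #|F| ^ 3 * #|H| ^ 2)%N.
Proof.
have <- : #|{: F * F * F * (H * H)}| = (#|F| ^ 3 * #|H| ^ 2)%N.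
  by rewrite !card_prod expnSr -!mulnn.
(* Every edge is named by its line and the types of its ends. *)
pose e (a : F * F * F * (H * H)) :=
  [set line_point a.1 a.2.1; line_point a.1 a.2.2].
apply: leq_trans (leq_imset_card e _).
apply/subset_leq_card/subsetP => a /imsetP [[u v]].
rewrite inE /= => /adj_line [l [uE vE]] ->.
by apply/imsetP; exists (l, (u.1, v.1)); rewrite // /e /= -uE -vE.
Qed.

(** A copy containing [e] lies on a line through both ends of [e], hence on the line of [e]. Its
    types form an injective endomorphism of [H], so it is the whole copy carried by that line. *)
Lemma unique_copy :
  (forall f : H -> cone_graph, ghom f -> injective f ->
     exists l, forall i, f i = line_point l (f i).1) ->
  forall e, e \in edges cone_graph ->
    exists! S : subgraph cone_graph,
      isomorphic (sgraph_of_subgraph S) H /\ e \in sub_edges S.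
Proof.
move=> on_line a /imsetP [[u v]]; rewrite inE /= => uv ->.
have [l [uE vE]] := adj_line uv; have /andP [ij _] := uv.
exists (image_subgraph (line_point_hom l)); split.
  split; first exact: image_subgraph_iso (line_point_inj (l := l)).
  rewrite uE vE (image_subgraph_edge (line_point_inj (l := l))).
  by rewrite /= ij.
move=> _ [/isomorphic_image_subgraph [f [hf [fI ->]]] eS].
have [l' fE] := on_line f hf fI.
pose g i := (f i).1.
have gI : injective g by move=> i j E; apply: fI; rewrite fE [RHS]fE -/(g i) E.
have gh : ghom g by move=> i j /hf /andP [].
have fg i : f i = line_point l' (g i) by exact: fE.
have ll' : l = l'.
  have im w : w \in [set u; v] -> w = line_point l' w.1.
    move: eS => /= /imsetP [e _ ->] /imsetP [i _ ->]; exact: fE.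
  apply: (@line_unique u.1 v.1).
  - by apply: contraTneq ij => ->; rewrite adj_irr.
  - by rewrite -uE -im ?set21.
  - by rewrite -vE -im ?set22.
apply: subgraph_inj => /=.
  apply/eqP; rewrite eq_sym eqEcard !card_imset //; last exact: line_point_inj.
  rewrite leqnn andbT; apply/subsetP => _ /imsetP [i _ ->].
  by rewrite fg ll' imset_f.
rewrite -[in LHS](imset_edges_endo gh gI) -imset_comp.
apply: eq_imset => e /=; rewrite -imset_comp ll'.
by apply: eq_imset => i /=; rewrite fg.
Qed.

End ConeGraph.

(** * Copies of H_k lie on lines *)

Lemma Hk_hub_edge k (i j : 'I_(2 * k)) :
  Hk_adj i j -> (4 <= i)%N -> (j < 4)%N.
Proof. rewrite /Hk_adj /Hk_arc !inE; lia. Qed.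

(** The side 2 <= i < k + 2 holds the labels 3, ..., k + 2: the hubs 3, 4 and the degree-2
    neighbours of 1, 2. *)
Lemma Hk_bipartite k (i j : 'I_(2 * k)) :
  Hk_adj i j -> (2 <= i < k + 2)%N = ~~ (2 <= j < k + 2)%N.
Proof. rewrite /Hk_adj /Hk_arc !inE; lia. Qed.

Section ConeHk.
Variables (F : finFieldType) (k : nat) (lam : Hk k -> F).
Hypothesis hk : (5 <= k)%N.
Hypothesis lam_inj : injective lam.
Hypothesis two_neq0 : 2%:R != 0 :> F.

(* Labels 1, 2, 3, 4 of H_k are the ordinals below 4; these "hubs" cover all
   edges, and all other vertices have degree 2. *)
Hypothesis lam_nonsquare : forall i i' j b : 'I_(2 * k), i != i' ->
  (j < 4)%N -> (4 <= b)%N -> Hk_adj i j -> Hk_adj i' j ->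
  Hk_adj i b -> Hk_adj i' b -> forall s : F, s ^+ 2 <>
  (lam b - lam i) * (lam b - lam i') * ((lam j - lam i) * (lam j - lam i')).

Let G := cone_graph lam.

Lemma card_Hk_hub_nbrs (i : 'I_(2 * k)) :
  (#|[set j : 'I_(2 * k) | Hk_adj i j && (j < 4)]| <= 2)%N.
Proof.
have lt_k m : (m < 4)%N -> (m < 2 * k)%N by lia.
pose o m (hm : (m < 4)%N) : 'I_(2 * k) := Ordinal (lt_k m hm).
pose A := [set o 0%N isT; o 1%N isT]; pose B := [set o 2%N isT; o 3%N isT].
have cA : (#|A| <= 2)%N by rewrite cards2; case: (_ != _).
have cB : (#|B| <= 2)%N by rewrite cards2; case: (_ != _).
suff : ([set j : 'I_(2 * k) | Hk_adj i j && (j < 4)%N] \subset A) ||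
       ([set j : 'I_(2 * k) | Hk_adj i j && (j < 4)%N] \subset B).
  by case/orP => /subset_leq_card /leq_trans; apply.
have [iA|iA] := boolP ((2 <= i < k + 2)%N); apply/orP; [left|right];
  apply/subsetP => j; rewrite !inE -!val_eqE /= /Hk_adj /Hk_arc !inE; lia.
Qed.

(** At most two hub types are available, each occurring at most twice; a fifth common neighbour
    escapes them. *)
Lemma many_common_neighbours (u v : G) : u != v ->
  (5 <= #|common_neighbours lam u v|)%N ->
  exists2 w, w \in common_neighbours lam u v & (4 <= w.1)%N.
Proof.
move=> uv N5; apply/exists_inP; apply: contraLR N5 => /exists_inPn hN.
rewrite -ltnNge ltnS; apply: leq_trans (_ : (2 * 2 <= 4)%N) => //.
apply: leq_trans (leq_mul (card_Hk_hub_nbrs u.1) (leqnn 2)).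
apply: (card_common_neighbours lam_inj two_neq0 uv) => w wN.
rewrite inE ltnNge hN // andbT.
by move: wN; rewrite inE => /andP [/andP [/= + _] _]; rewrite Hk_adj_sym.
Qed.

Lemma many_common_neighbours_hub (u v : G) : u != v ->
  (5 <= #|common_neighbours lam u v|)%N -> (u.1 < 4)%N.
Proof.
move=> uv /(many_common_neighbours uv) [w].
rewrite inE => /andP [/andP [wu _] _]; exact: Hk_hub_edge wu.
Qed.

(** Let [b] be a common neighbour of degree-2 type. If D = [cone_form lam u v] were nonzero,
    multiplying [disc_root_sqr] for [b] and [w] and dividing by D^2 would make the product in
    [lam_nonsquare] a square. *)
Lemma many_common_neighbours_line (u v w : G) : u != v ->
  (5 <= #|common_neighbours lam u v|)%N -> w \in common_neighbours lam u v ->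
  (w.1 < 4)%N -> u.1 != v.1 -> cone_form lam u v = 0.
Proof.
move=> uv /(many_common_neighbours uv) [b bN b4] wN w4 uv1.
apply/eqP; apply/negPn/negP => D0.
move: bN wN; rewrite !inE => /andP [bu bv] /andP [wu wv].
have Db := disc_root_sqr bu bv; have Dw := disc_root_sqr wu wv.
have /andP [/= bu1 _] := bu; have /andP [/= bv1 _] := bv.
have /andP [/= wu1 _] := wu; have /andP [/= wv1 _] := wv.
rewrite Hk_adj_sym in bu1; rewrite Hk_adj_sym in bv1.
rewrite Hk_adj_sym in wu1; rewrite Hk_adj_sym in wv1.
apply: (lam_nonsquare uv1 w4 b4 wu1 wv1 bu1 bv1
  (s := disc_root lam u v b * disc_root lam u v w / cone_form lam u v)).
by rewrite !exprMn Db Dw; field.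
Qed.

(** A pair of distinct types lies on a line, which then contains the other pair, there being no
    triangles off a line. If both pairs had equal types, [common_neighbour_same_type] would give w =
    z. *)
Lemma crossed_pairs_line (u v w z : G) : u != v -> w != z ->
  [&& cone_adj lam u w, cone_adj lam u z, cone_adj lam v w
    & cone_adj lam v z] ->
  (5 <= #|common_neighbours lam u v|)%N ->
  (5 <= #|common_neighbours lam w z|)%N ->
  exists l, [/\ u = line_point lam l u.1, v = line_point lam l v.1,
                w = line_point lam l w.1 & z = line_point lam l z.1].
Proof.
move=> uv wz /and4P [uw uz vw vz] Nuv Nwz.
have [wu zu wv zv] :
    [/\ cone_adj lam w u, cone_adj lam z u, cone_adj lam w v
      & cone_adj lam z v].
  by rewrite !(cone_adj_sym _ w) !(cone_adj_sym _ z).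
have w4 := many_common_neighbours_hub wz Nwz.
have u4 := many_common_neighbours_hub uv Nuv.
have wN : w \in common_neighbours lam u v by rewrite inE wu wv.
have zN : z \in common_neighbours lam u v by rewrite inE zu zv.
have uN : u \in common_neighbours lam w z by rewrite inE uw uz.
have vN : v \in common_neighbours lam w z by rewrite inE vw vz.
have [uv1|uv1] := eqVneq u.1 v.1; last first.
  have D0 := many_common_neighbours_line uv Nuv wN w4 uv1.
  have [|l [uE vE]] := line_through _ D0; first by rewrite (inj_eq lam_inj).
  exists l; rewrite uE vE in wu wv zu zv; split=> //.
    exact: (line_common_neighbour lam_inj uv1 wu wv).
  exact: (line_common_neighbour lam_inj uv1 zu zv).
have [wz1|wz1] := eqVneq w.1 z.1; last first.
  have D0 := many_common_neighbours_line wz Nwz uN u4 wz1.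
  have [|l [wE zE]] := line_through _ D0; first by rewrite (inj_eq lam_inj).
  exists l; rewrite wE zE in uw uz vw vz; split=> //.
    exact: (line_common_neighbour lam_inj wz1 uw uz).
  exact: (line_common_neighbour lam_inj wz1 vw vz).
have := common_neighbour_same_type lam_inj two_neq0 uv uv1 wN zN wz1.
by move=> E; rewrite E eqxx in wz.
Qed.

(** Labels 1, 2 have k common neighbours, and so have 3, 4; hence the four hubs go to one line.
    Every vertex is adjacent to both hubs of some pair, so it follows them. *)
Lemma Hk_copy_line (f : Hk k -> G) : ghom f -> injective f ->
  exists l, forall i, f i = line_point lam l (f i).1.
Proof.
move=> hf fI.
have lt_k m : (m < 4)%N -> (m < 2 * k)%N by lia.
pose o m (hm : (m < 4)%N) : Hk k := Ordinal (lt_k m hm).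
pose a := o 0%N isT; pose b := o 1%N isT.
pose c := o 2%N isT; pose d := o 3%N isT.
have abN (i : 'I_(2 * k)) : (2 <= i < k + 2)%N -> Hk_adj i a && Hk_adj i b.
  by rewrite /Hk_adj /Hk_arc !inE /=; lia.
have cdN (i : 'I_(2 * k)) : ~~ (2 <= i < k + 2)%N -> Hk_adj i c && Hk_adj i d.
  by have := ltn_ord i; rewrite /Hk_adj /Hk_arc !inE /=; lia.
have card_nbrs (A : {set 'I_(2 * k)}) (x y : Hk k) :
    (forall i, i \in A -> Hk_adj i x && Hk_adj i y) -> (k <= #|A|)%N ->
    (5 <= #|common_neighbours lam (f x) (f y)|)%N.
  move=> AN kA; apply: leq_trans (leq_trans hk kA) _.
  rewrite -(card_imset _ fI); apply/subset_leq_card/subsetP.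
  move=> _ /imsetP [i /AN /andP [ix iy] ->].
  by rewrite inE; apply/andP; split; [exact: hf ix | exact: hf iy].
pose A := [set i : 'I_(2 * k) | (2 <= i < k + 2)%N].
have cardA : #|A| = k.
  rewrite -[RHS]card_ord.
  have hg (i : 'I_k) : (i + 2 < 2 * k)%N by have := ltn_ord i; lia.
  rewrite -(card_codom (f := fun i : 'I_k => Ordinal (hg i))); last first.
    by move=> i j [] /addIn /val_inj.
  apply: eq_card => i; rewrite inE.
  apply/idP/codomP => [iA|[j ->]] /=; last first.
    by have := ltn_ord j; lia.
  have hi : (i - 2 < k)%N by lia.
  by exists (Ordinal hi); apply: val_inj => /=; lia.
have cardAC : #|~: A| = k.
  have := cardsC A; rewrite cardA card_ord; lia.
have Nab : (5 <= #|common_neighbours lam (f a) (f b)|)%N.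
  by apply: (card_nbrs A); rewrite ?cardA // => i; rewrite inE => /abN.
have Ncd : (5 <= #|common_neighbours lam (f c) (f d)|)%N.
  by apply: (card_nbrs (~: A)); rewrite ?cardAC // => i; rewrite !inE => /cdN.
have fN x y : x != y -> f x != f y by rewrite (inj_eq fI).
have ab : a != b by []. have cd : c != d by [].
have [|l [aE bE cE dE]] :=
    crossed_pairs_line (fN _ _ ab) (fN _ _ cd) _ Nab Ncd.
  by apply/and4P; split; apply: hf; rewrite /= /Hk_adj /Hk_arc /= ?inE; lia.
have nbr_line x y : x != y -> f x = line_point lam l (f x).1 ->
    f y = line_point lam l (f y).1 -> forall i, Hk_adj i x && Hk_adj i y ->
    f i = line_point lam l (f i).1.
  move=> xy xE yE i /andP [/hf ix /hf iy]; rewrite xE in ix; rewrite yE in iy.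
  apply: (line_common_neighbour lam_inj _ ix iy).
  by apply: contra_neq xy => E; apply: fI; rewrite xE yE E.
exists l => i; have [iA|iA] := boolP (2 <= i < k + 2)%N.
  exact: (nbr_line a b ab aE bE i (abN i iA)).
exact: (nbr_line c d cd cE dE i (cdN i iA)).
Qed.

End ConeHk.

(** * Choosing the values lambda_i *)

Lemma exists_nonsquare (F : finFieldType) : 2%:R != 0 :> F ->
  exists nu : F, forall s, s ^+ 2 != nu.
Proof.
move=> two_neq0.
suff /existsP [nu /forallP nuP] : [exists nu : F, [forall s : F, s ^+ 2 != nu]].
  by exists nu.
apply: contraT => /existsPn sq.
have sqS (nu : F) : nu \in codom (fun s : F => s ^+ 2).
  have := sq nu; rewrite negb_forall => /existsP [s /negPn /eqP <-].
  exact: codom_f.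
(* On a finite field surjective squaring would be injective, yet 1 and -1 have equal squares. *)
have /injectiveP sqI : injectiveb (fun s : F => s ^+ 2).
  apply/card_uniqP; rewrite size_codom; apply: eq_card => nu; exact: sqS.
suff /eqP : 1 = -1 :> F by rewrite -subr_eq0 opprK (negbTE two_neq0).
by apply: sqI; rewrite sqrrN.
Qed.

(** [a] is a candidate value for a degree-2 vertex whose two hubs have values [d] and [- d]; [c] is
    the factor contributed by a hub type [j]. *)
Definition nonsquare_values (F : finFieldType) (c d : F) : {set F} :=
  [set a | [forall s : F, s ^+ 2 != c * (a ^+ 2 - d ^+ 2)]].

(* For nu a nonsquare, a := d (1 + r) / (1 - r) with r := c nu z ^ 2 makes
   c (a ^ 2 - d ^ 2) = nu (2 c d z / (1 - r)) ^ 2 a nonsquare. *)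
Lemma card_nonsquare_values (F : finFieldType) (c d : F) (n : nat) :
  2%:R != 0 :> F -> c != 0 -> d != 0 -> (n * 2 + 3 <= #|F|)%N ->
  (n <= #|nonsquare_values c d|)%N.
Proof.
move=> two_neq0 c0 d0 nF; rewrite -(@leq_pmul2r 2) // -(leq_add2r 3).
apply: leq_trans nF _. have [nu nuP] := exists_nonsquare two_neq0.
have nu0 : nu != 0 by have := nuP 0; rewrite expr0n /= eq_sym.
(* At most three z are excluded: 0 and the roots of c nu z^2 = 1. As [f z] determines z^2, [f] is at
   most two-to-one; hence the bound n * 2 + 3. *)
pose D := [set z : F | (z != 0) && (1 - c * nu * z ^+ 2 != 0)].
pose f z := d * (1 + c * nu * z ^+ 2) / (1 - c * nu * z ^+ 2).
have cDC : (#|~: D| <= 3)%N.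
  pose R := [set z : F | z ^+ 2 == (c * nu)^-1].
  apply: (@leq_trans #|0 |: R|); last first.
    by rewrite cardsU1 (leq_add (leq_b1 _)) ?card_sqrt.
  apply/subset_leq_card/subsetP => z; rewrite !inE negb_and !negbK.
  case/orP => [-> //|/eqP E]; apply/orP; right; apply/eqP.
  have cnu0 : c * nu != 0 by rewrite mulf_neq0.
  apply: (mulfI cnu0); rewrite divff //; apply/esym/eqP.
  by rewrite -subr_eq0 E.
rewrite -(cardsC D); apply: leq_add => //.
have fD z : z \in D -> f z \in nonsquare_values c d.
  rewrite !inE => /andP [z0 r1]; apply/forallP => s; apply/negP => /eqP E.
  have := nuP (s * (1 - c * nu * z ^+ 2) / (2%:R * d * c * z)).
  rewrite !exprMn E /f => /eqP; apply.
  by field; rewrite r1 z0 c0 d0 two_neq0.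
rewrite -sum1_card (partition_big f (mem (nonsquare_values c d))) //=.
rewrite -sum_nat_const; apply: leq_sum => a _; rewrite sum1_card.
apply: leq_trans (card_sqrt ((a - d) / (a + d) / (c * nu))).
apply/subset_leq_card/subsetP => z /andP []; rewrite !inE.
move=> /andP [z0 r1] /eqP <-; apply/eqP; rewrite /f; field.
rewrite nu0 c0 r1 /=.
rewrite (_ : _ + _ = 2%:R * d); last by ring.
by rewrite mulf_neq0.
Qed.

Lemma nonsquare_valuesP (F : finFieldType) (c d a s : F) :
  a \in nonsquare_values c d -> s ^+ 2 <> c * (a ^+ 2 - d ^+ 2).
Proof. by rewrite inE => /forallP /(_ s) /eqP. Qed.

Lemma uniq_seq_avoiding (T : finType) (A : {set T}) (t : seq T) n :
  (n + size t <= #|A|)%N ->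
  exists s : seq T, [/\ uniq (t ++ s) = uniq t, size s = n & {subset s <= A}].
Proof.
move=> nA; pose B := A :\: [set x in t].
have nB : (n <= #|B|)%N.
  have := cardsID [set x in t] A; rewrite -/B => E.
  have : (#|A :&: [set x in t]| <= size t)%N.
    apply: leq_trans (card_size t); apply/subset_leq_card/subsetP => x.
    by rewrite !inE => /andP [].
  lia.
have sB x : x \in take n (enum B) -> x \in B by move/mem_take; rewrite mem_enum.
exists (take n (enum B)); split.
- rewrite cat_uniq take_uniq ?enum_uniq // andbT.
  rewrite (_ : has _ _ = false) ?andbT //; apply/negbTE/hasPn => x /sB.
  by rewrite !inE => /andP [].
- by rewrite size_take -cardE; case: ltngtP nB.
- by move=> x /sB; rewrite inE => /andP [].
Qed.

Lemma exists_separated_values (F : finFieldType) (k : nat) :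
  (2 <= k)%N -> 2%:R != 0 :> F -> 3%:R != 0 :> F -> (4 * k + 20 <= #|F|)%N ->
  exists lam : 'I_(2 * k) -> F, injective lam /\
    forall i i' j b : 'I_(2 * k), i != i' ->
    (j < 4)%N -> (4 <= b)%N -> Hk_adj i j -> Hk_adj i' j ->
    Hk_adj i b -> Hk_adj i' b -> forall s : F, s ^+ 2 <>
    (lam b - lam i) * (lam b - lam i') * ((lam j - lam i) * (lam j - lam i')).
Proof.
move=> k2 two_neq0 three_neq0 Fbig.
(* Hubs 1, 2 get 1, -1 and hubs 3, 4 get 2, -2, so the factor of [j] is independent of [j]: (j - 1)
   (j + 1) = 3 at j = 2, -2, and (j - 2) (j + 2) = -3 at j = 1, -1. *)
pose t : seq F := [:: 1; -1; 2%:R; - 2%:R].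
have t_uniq : uniq t.
  rewrite /t /= !inE !negb_or andbT -!andbA.
  have four_neq0 : 2%:R - - 2%:R != 0 :> F.
    by rewrite (_ : _ - _ = 2%:R * 2%:R) ?mulf_neq0 //; ring.
  apply/and5P; split; rewrite -subr_eq0.
  - by rewrite opprK.
  - by rewrite (_ : 1 - 2%:R = -1) ?oppr_eq0 ?oner_eq0 //; ring.
  - by rewrite (_ : 1 - - 2%:R = 3%:R) //; ring.
  - by rewrite (_ : -1 - 2%:R = - 3%:R) ?oppr_eq0 //; ring.
  - rewrite -[2%:R == _]subr_eq0 four_neq0 andbT.
    by rewrite (_ : -1 - - 2%:R = 1) ?oner_eq0 //; ring.
have m30 : - 3%:R != 0 :> F by rewrite oppr_eq0.
have [|sa [ua za sA]] :=
    @uniq_seq_avoiding F (nonsquare_values 3%:R 1) t (k - 2).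
  apply: card_nonsquare_values; rewrite ?oner_neq0 //.
  by apply: leq_trans Fbig; rewrite /t /=; lia.
(* Finding k - 2 values outside k + 2 earlier ones takes 2k candidates, so 4k + 3 field elements
   suffice. *)
have [|sb [ub zb sB]] :=
    @uniq_seq_avoiding F (nonsquare_values (- 3%:R) 2%:R) (t ++ sa) (k - 2).
  apply: card_nonsquare_values => //.
  by apply: leq_trans Fbig; rewrite size_cat za /t /=; lia.
have size_s : size ((t ++ sa) ++ sb) = (2 * k)%N.
  by rewrite !size_cat za zb /t /=; lia.
pose lam (i : 'I_(2 * k)) := ((t ++ sa) ++ sb)`_i.
exists lam; split.
  move=> i j /eqP; rewrite nth_uniq ?size_s //; first by move/eqP/val_inj.
  by rewrite ub ua t_uniq.
have lam_t (i : 'I_(2 * k)) : (i < 4)%N -> lam i = t`_i.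
  by move=> i4; rewrite /lam -catA nth_cat /= i4.
have lam_A (i : 'I_(2 * k)) : (4 <= i < k + 2)%N ->
    lam i \in nonsquare_values 3%:R 1.
  move=> iA; apply: sA; rewrite /lam nth_cat size_cat za.
  rewrite (_ : (i < 4 + (k - 2))%N); last by lia.
  rewrite nth_cat /= (_ : (i < 4)%N = false); last by lia.
  by apply: mem_nth; rewrite za; lia.
have lam_B (i : 'I_(2 * k)) : (k + 2 <= i)%N ->
    lam i \in nonsquare_values (- 3%:R) 2%:R.
  move=> iB; apply: sB; rewrite /lam nth_cat size_cat za.
  rewrite (_ : (i < 4 + (k - 2))%N = false); last by lia.
  by apply: mem_nth; have := ltn_ord i; rewrite zb /t /=; lia.
move=> i i' j b ii' j4 b4 ij i'j ib i'b s.
(* So [i], [i'] are the two hubs of one pair and [j] belongs to the other. *)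
have [iS i'S jS] : [/\ (2 <= i < k + 2)%N = ~~ (2 <= b < k + 2)%N,
    (2 <= i' < k + 2)%N = ~~ (2 <= b < k + 2)%N &
    (2 <= j < k + 2)%N = (2 <= b < k + 2)%N].
  split; [exact: Hk_bipartite | exact: Hk_bipartite |].
  by rewrite -[LHS]negbK -(Hk_bipartite ij) (Hk_bipartite ib) negbK.
have i4 : (i < 4)%N by rewrite Hk_adj_sym in ib; exact: Hk_hub_edge ib b4.
have i'4 : (i' < 4)%N by rewrite Hk_adj_sym in i'b; exact: Hk_hub_edge i'b b4.
clear ib i'b ij i'j.
rewrite (lam_t i) // (lam_t i') // (lam_t j) //.
have nii' : (i : nat) != i' by [].
have eA (m m' n : nat) : (m < 2)%N -> (m' < 2)%N -> m != m' -> (2 <= n < 4)%N ->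
    forall a, (a - t`_m) * (a - t`_m') * ((t`_n - t`_m) * (t`_n - t`_m')) =
    3%:R * (a ^+ 2 - 1 ^+ 2).
  by case: m m' n => [|[|m]] [|[|m']] [|[|[|[|n]]]] // _ _ _ _ a /=; ring.
have eB (m m' n : nat) : (2 <= m < 4)%N -> (2 <= m' < 4)%N -> m != m' ->
    (n < 2)%N ->
    forall a, (a - t`_m) * (a - t`_m') * ((t`_n - t`_m) * (t`_n - t`_m')) =
    - 3%:R * (a ^+ 2 - 2%:R ^+ 2).
  by case: m m' n => [|[|[|[|m]]]] [|[|[|[|m']]]] [|[|n]] // _ _ _ _ a /=; ring.
have [bA|bB] := ltnP b (k + 2).
  have /lam_A bN : (4 <= b < k + 2)%N by rewrite b4.
  rewrite eA //; first exact: nonsquare_valuesP bN.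
  - by clear -k2 bA b4 iS i4; lia.
  - by clear -k2 bA b4 i'S i'4; lia.
  - by clear -k2 bA b4 jS j4; lia.
rewrite eB //; first exact: nonsquare_valuesP (lam_B _ bB).
- by clear -k2 bB b4 iS i4; lia.
- by clear -k2 bB b4 i'S i'4; lia.
- by clear -k2 bB b4 jS j4; lia.
Qed.

(** * The graph for one prime *)

Definition edgeless (T : finType) : sgraph :=
  @SGraph T (fun _ _ => false) (fun _ _ => erefl) (fun _ => erefl).

Lemma edges_edgeless (T : finType) : edges (edgeless T) = set0.
Proof. by apply/setP => e; rewrite inE; apply/imsetP => [[u]]; rewrite inE. Qed.

Lemma exists_graph (k p : nat) : (5 <= k)%N -> prime p ->
  exists G : sgraph,
    [/\ #|G| = (2 * k * p ^ 2)%N,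
        (4 * k + 20 <= p)%N ->
          (p ^ 3 <= #|edges G| <= p ^ 3 * (2 * k) ^ 2)%N &
        forall e, e \in edges G ->
          exists! S : subgraph G,
            isomorphic (sgraph_of_subgraph S) (Hk k) /\ e \in sub_edges S].
Proof.
move=> hk pr; have [p_big|p_small] := leqP (4 * k + 20) p; last first.
  exists (edgeless 'I_(2 * k * p ^ 2)); rewrite edges_edgeless; split.
  - by rewrite card_ord.
  - by [].
  - by move=> e; rewrite inE.
have small_neq0 n : (0 < n < 4)%N -> n%:R != 0 :> 'F_p.
  by move=> n4; rewrite -(dvdn_pcharf (pchar_Fp pr)) gtnNdvd //; lia.
have [||||lam [lam_inj lamP]] := @exists_separated_values 'F_p k.
- by lia.
- exact: small_neq0.
- exact: small_neq0.
- by rewrite card_Fp.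
pose lam' : Hk k -> 'F_p := lam.
exists (cone_graph lam'); split.
- by rewrite card_cone_graph card_ord card_Fp.
- move=> _; have o0 : (0 < 2 * k)%N by lia.
  (* Ordinals 0 and 2 are the labels 1 and 3, which are adjacent. *)
  have o2 : (2 < 2 * k)%N by lia.
  have := @card_edges_ge _ _ lam' lam_inj (Ordinal o0) (Ordinal o2).
  have := card_edges_le (lam := lam') lam_inj.
  rewrite card_Fp // (card_ord (2 * k) : #|Hk k| = _) => -> -> //.
  by rewrite /= /Hk_adj /Hk_arc /= ?inE; lia.
- apply: (unique_copy (lam := lam') lam_inj) => f.
  by apply: Hk_copy_line => //; exact: small_neq0.
Qed.

(* Order of growth of the number of edges *)
From mathcomp Require Import all_classical all_reals all_analysis.
Import numFieldNormedType.Exports.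

Local Open Scope classical_set_scope.
Local Open Scope ring_scope.

Theorem theorem1p1 (R : realType) (k : nat) (hk : (5 <= k)%N) :
  exists G : nat -> sgraph,
    [/\ forall p : nat, prime_1mod4 p -> #|G p| = (2 * k * p ^ 2)%N,
        (fun p : nat => #|edges (G p)|%:R : R^o) \is
          'Theta_(within [set p | prime_1mod4 p] \oo)
            (fun p : nat => (2 * k * p ^ 2)%N%:R `^ (3 / 2) : R^o) &
        forall p : nat, prime_1mod4 p ->
          forall e : {set G p}, e \in edges (G p) ->
            exists! S : subgraph (G p),
              isomorphic (sgraph_of_subgraph S) (Hk k) /\ e \in sub_edges S].
Proof.
have /choice [G GP] (p : nat) : exists G : sgraph, prime p ->
    [/\ #|G| = (2 * k * p ^ 2)%N,
        (4 * k + 20 <= p)%N ->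
          (p ^ 3 <= #|edges G| <= p ^ 3 * (2 * k) ^ 2)%N &
        forall e, e \in edges G ->
          exists! S : subgraph G,
            isomorphic (sgraph_of_subgraph S) (Hk k) /\ e \in sub_edges S].
  have [/(exists_graph hk) [G GP]|_] := boolP (prime p); first by exists G.
  (* A placeholder for nonprime indices. *)
  by exists (edgeless void).
exists G; split; last by move=> p [/GP []].
  by move=> p [/GP []].
(* With n = 2k p^2, n^(3/2) = c p^3, so p^3 <= edges <= (2k)^2 p^3 yields the constants 1 / c and
   (2k)^2 / c. *)
pose c : R := (2 * k)%:R `^ (3 / 2).
have c0 : 0 < c by rewrite powR_gt0 // ltr0n; lia.
have powE (p : nat) : (2 * k * p ^ 2)%N%:R `^ (3 / 2) = c * p%:R ^+ 3 :> R.
  rewrite natrM powRM // natrX -(powR_mulrn 2) // -powRrM.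
  by rewrite (_ : 2%:R * (3 / 2) = 3%:R) ?powR_mulrn //; field.
apply/asboolP; exists (c^-1, (2 * k)%:R ^+ 2 / c) => /=.
  by rewrite invr_gt0 c0 divr_gt0 // exprn_gt0 // ltr0n; lia.
exists (4 * k + 20)%N => // p /= p_big [/GP [_ /(_ p_big) /andP [E1 E2] _] _].
rewrite powE !ger0_norm ?mulr_ge0 ?exprn_ge0 ?ler0n ?(ltW c0) //.
rewrite mulrA mulVf ?gt_eqF // mul1r mulrA divfK ?gt_eqF // mulrC.
by rewrite -!natrX -natrM !ler_nat.
Qed.
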